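(* Let $W$ be an absolutely reducible representation of $A$ of dimension $n$, with a fixed basis $\{w_1,\dots,w_n\}$. Then there are a set map $u:\{1,\ldots,n\}\to\{1,\ldots,r\}$ and a normalized invertible matrix $X\in GL_n(K)$ (with respect to $u$) that define the action of $A$ on $W$.
   Context: $K$ is a field, $A$ is a finite-dimensional (associative unital) $K$-algebra, and $\mathrm{Alg}_K(A,K)=\{\theta_1,\ldots,\theta_r\}$ is the (finite) set of algebra morphisms $A\to K$, the $\theta_i$ being distinct. An $n$-dimensional $A$-module $W$ is absolutely reducible if it is a direct sum of $n$ submodules of dimension one. Given a basis $\{w_1,\ldots,w_n\}$ of $W$, the module structure is encoded by the linear maps $\omega_{ij}:A\to K$ with $a w_i=\sum_{j=1}^n\omega_{ji}(a)w_j$; write $\boldsymbol{\omega}=(\omega_{ij})_{i,j}$. A matrix $X\in GL_n(K)$ and a map $u:\{1,\ldots,n\}\to\{1,\ldots,r\}$ define the action of $A$ on $W$ if $\boldsymbol{\omega}=X\cdot\mathrm{diag}(\theta_{u(1)},\ldots,\theta_{u(n)})\cdot X^{-1}$. Normalized matrices: given $u$, let $\mathrm{Im}(u)=\{i_1<\cdots<i_s\}$, $F_k=u^{-1}(i_k)$ and $n_k=\#F_k$. For $X=(x_{ij})\in GL_n(K)$, let $X^k\in M_{n,n_k}(K)$ be the submatrix of $X$ formed by the columns with index in $F_k$ (in increasing order). For a matrix $Y$ with $n$ rows and $\sigma\in S_n$, $Y_\sigma$ is the matrix whose $i$-th row is the $\sigma(i)$-th row of $Y$. A matrix $X\in GL_n(K)$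 is called a normalized invertible matrix (with respect to $u$) if for every $k\in\{1,\ldots,s\}$ there are $Z_k\in M_{n-n_k,n_k}(K)$ and $\sigma_k\in S_n$ such that $X^k=\begin{pmatrix}I_{n_k}\\ Z_k\end{pmatrix}_{\sigma_k}$. *)

(* Defs.v *)
From HB Require Import structures.
From mathcomp Require Import all_boot all_order all_fingroup all_algebra all_field.

Set Implicit Arguments.
Unset Strict Implicit.
Unset Printing Implicit Defensive.

Import GRing.Theory.
Local Open Scope ring_scope.

(* The set Alg_K(A, K) is {theta_0, ..., theta_(r-1)}, with distinct theta_i.
   Bundled morphisms are compared extensionally. *)
Definition enumerates_characters (K : fieldType) (A : falgType K) (r : nat)
    (theta : 'I_r -> {lrmorphism A -> K | *%R}) : Prop :=
  (forall i j, theta i =1 theta j -> i = j) /\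
  (forall f : {lrmorphism A -> K | *%R}, exists i, f =1 theta i).

(* A left A-module structure on the K-space W; stated for the composition \o
   since 'End(W) is a MathComp ring only when W is nontrivial. *)
Definition module_action (K : fieldType) (A : falgType K) (W : vectType K)
    (rho : {linear A -> 'End(W)}) : Prop :=
  rho 1 = \1%VF /\ (forall a b, rho (a * b) = (rho a \o rho b)%VF).

Definition submodule (K : fieldType) (A : falgType K) (W : vectType K)
    (rho : {linear A -> 'End(W)}) (U : {vspace W}) : Prop :=
  forall a, (rho a @: U <= U)%VS.

Definition absolutely_reducible (K : fieldType) (A : falgType K)
    (W : vectType K) (rho : {linear A -> 'End(W)}) (n : nat) : Prop :=
  \dim {:W} = n /\
  exists U : 'I_n -> {vspace W},
    [/\ forall i, submodule rho (U i),
        forall i, \dim (U i) = 1%N,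
        directv (\sum_(i < n) U i)%VS
      & (\sum_(i < n) U i)%VS = fullv].

(* omega(a): its (i, j) entry is the coordinate of a w_j on w_i. *)
Definition action_matrix (K : fieldType) (A : falgType K) (W : vectType K)
    (rho : {linear A -> 'End(W)}) (n : nat) (w : n.-tuple W) (a : A) : 'M[K]_n :=
  \matrix_(i, j) coord w i (rho a w`_j).

Lemma action_matrixE (K : fieldType) (A : falgType K) (W : vectType K)
    (rho : {linear A -> 'End(W)}) (n : nat) (w : n.-tuple W) (a : A) (i : 'I_n) :
  basis_of fullv w ->
  rho a w`_i = \sum_(j < n) action_matrix rho w a j i *: w`_j.
Proof.
move=> wB; apply: etrans (coord_basis wB (memvf _)) _.
by apply: eq_bigr => j _; rewrite mxE.
Qed.

Definition defines_action (K : fieldType) (A : falgType K) (W : vectType K)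
    (rho : {linear A -> 'End(W)}) (n : nat) (w : n.-tuple W)
    (r : nat) (theta : 'I_r -> {lrmorphism A -> K | *%R})
    (u : 'I_n -> 'I_r) (X : 'M[K]_n) : Prop :=
  X \in unitmx /\
  forall a, action_matrix rho w a =
    X *m diag_mx (\row_(j < n) theta (u j) a) *m invmx X.

Definition fiber (n r : nat) (u : 'I_n -> 'I_r) (k : 'I_r) : {set 'I_n} :=
  [set j | u j == k].

Lemma card_fiber_le (n r : nat) (u : 'I_n -> 'I_r) (k : 'I_r) :
  (#|fiber u k| <= n)%N.
Proof. by rewrite -[X in (_ <= X)%N](card_ord n) max_card. Qed.

(* enum_val lists the elements of the fiber in increasing order. *)
Definition fiber_columns (K : fieldType) (n r : nat) (u : 'I_n -> 'I_r)
    (X : 'M[K]_n) (k : 'I_r) : 'M[K]_(n, #|fiber u k|) :=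
  colsub (@enum_val _ (mem (fiber u k))) X.

(* row_perm s Y has the s(i)-th row of Y as its i-th row. *)
Definition normalized_invertible (K : fieldType) (n r : nat)
    (u : 'I_n -> 'I_r) (X : 'M[K]_n) : Prop :=
  X \in unitmx /\
  forall k, k \in codom u ->
    exists (Z : 'M[K]_(n - #|fiber u k|, #|fiber u k|)) (s : 'S_n),
      fiber_columns u X k =
        row_perm s (castmx (subnKC (card_fiber_le u k), erefl)
                           (col_mx 1%:M Z)).

(* Main.v *)
(* Each one-dimensional summand of W is a line on which A acts through a
   character, so a basis of W adapted to the decomposition gives an invertible X0
   diagonalizing the action.  For each k the columns of X0 indexed by F_k are
   independent, hence contain an invertible square block; let f send F_k
   injectively to the rows of this block.  The block-diagonal matrix Q made of
   these blocks is invertible and commutes with diag(theta_(u j)), so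
   X = X0 Q^-1 diagonalizes the action too, and now the rows f(F_k) of its
   columns F_k form the identity matrix. *)
Require Import Defs.
From mathcomp Require Import all_boot all_order all_fingroup all_algebra all_field.
From HB Require Import structures.

Set Implicit Arguments.
Unset Strict Implicit.

Import GRing.Theory.
Local Open Scope ring_scope.

(** List the image of [f] in order, then its complement: sending each element of ['I_n] to its
    position in this list is the permutation wanted. *)
Lemma perm_extends_inj (m n : nat) (le_mn : (m <= n)%N) (f : 'I_m -> 'I_n) :
  injective f -> exists s : 'S_n, forall i, s (f i) = widen_ord le_mn i.
Proof.
move=> f_inj; pose L := codom f ++ enum [predC codom f].
have L_all i : i \in L by rewrite mem_cat mem_enum inE; case: (i \in codom f).
have sizeL : size L = n.
  rewrite size_cat -cardE size_codom card_ord -[X in (X + _)%N](card_ord m).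
  by rewrite -(card_codom f_inj) cardC card_ord.
have ltL i : (index i L < n)%N by rewrite -[X in (_ < X)%N]sizeL index_mem.
have s_inj : injective (fun i => Ordinal (ltL i)).
  by move=> i j [eq_ij]; rewrite -(nth_index i (L_all i)) eq_ij nth_index.
exists (perm s_inj) => i; apply/val_inj; rewrite permE /= index_cat codom_f.
by rewrite /codom /image_mem index_map // index_enum_ord.
Qed.

(** A scalar is determined by its multiple of the nonzero [v], so linearity and multiplicativity of
    [rho] pass to the eigenvalue. *)
Lemma eigenvector_character (K : fieldType) (A : falgType K) (W : vectType K)
    (rho : {linear A -> 'End(W)}) (v : W) :
  module_action rho -> v != 0 -> submodule rho <[v]>%VS ->
  exists f : {lrmorphism A -> K | *%R}, forall a, rho a v = f a *: v.
Proof.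
move=> [rho1 rhoM] v_nz v_sub.
pose f (a : A) : K := coord [tuple v] ord0 (rho a v).
have fE a : rho a v = f a *: v.
  have /vlineP[c rho_av] : rho a v \in <[v]>%VS.
    exact: subvP (v_sub a) _ (memv_img _ (memv_line v)).
  have v_free : free [tuple v] by rewrite /= seq1_free.
  by rewrite /f rho_av linearZ /= (coord_free ord0 ord0) // mulr1.
have scaler_v_inj : injective (fun c : K => c *: v).
  by move=> c d /eqP; rewrite -subr_eq0 -scalerBl scaler_eq0 (negPf v_nz) orbF
     subr_eq0 => /eqP.
have f_lin : linear_for *%R f.
  by move=> c a b; apply: scaler_v_inj; rewrite -fE linearP /=
     add_lfunE scale_lfunE !fE scalerA -scalerDl.
have f_mul : monoid_morphism f.
  split=> [|a b]; apply: scaler_v_inj.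
    by rewrite -fE rho1 id_lfunE scale1r.
  by rewrite -fE rhoM comp_lfunE fE linearZ /= fE scalerA mulrC.
pose F : {lrmorphism A -> K | *%R} := HB.pack f
  (GRing.isLinear.Build K A K *%R f f_lin)
  (GRing.isMonoidMorphism.Build A K f f_mul).
by exists F.
Qed.

Lemma eigenbasis (K : fieldType) (A : falgType K) (r : nat)
    (theta : 'I_r -> {lrmorphism A -> K | *%R}) (W : vectType K)
    (rho : {linear A -> 'End(W)}) (n : nat) :
  enumerates_characters theta -> module_action rho ->
  absolutely_reducible rho n ->
  exists (u : 'I_n -> 'I_r) (e : 'I_n -> W),
    (forall i a, rho a (e i) = theta (u i) a *: e i) /\
    (forall c : 'I_n -> K, \sum_i c i *: e i = 0 -> forall i, c i = 0).
Proof.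
move=> [_ theta_all] rho_act [_ [U [U_sub dimU U_dir _]]].
pose e i := vpick (U i).
have e_nz i : e i != 0 by rewrite vpick0 -dimv_eq0 dimU.
have Ue i : U i = <[e i]>%VS.
  by apply/esym/eqP; rewrite eqEdim -memvE memv_pick dim_vline dimU e_nz.
have /fin_all_exists[u uE] : forall i, exists k, forall a,
    rho a (e i) = theta k a *: e i.
  move=> i; have ei_sub : submodule rho <[e i]>%VS by rewrite -Ue.
  have [f fE] := eigenvector_character rho_act (e_nz i) ei_sub.
  by have [k fk] := theta_all f; exists k => a; rewrite -fk.
exists u, e; split=> // c sum0 i.
have ce0 : c i *: e i = 0.
  apply: (directv_sum_independent U_dir (fun i => c i *: e i)) => // j _.
  by rewrite rpredZ ?memv_pick.
by apply/eqP; move/eqP: ce0; rewrite scaler_eq0 (negPf (e_nz i)) orbF.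
Qed.

Lemma diagonalizing_matrix (K : fieldType) (A : falgType K) (r : nat)
    (theta : 'I_r -> {lrmorphism A -> K | *%R}) (W : vectType K)
    (rho : {linear A -> 'End(W)}) (n : nat) (w : n.-tuple W) :
  enumerates_characters theta -> module_action rho ->
  absolutely_reducible rho n -> basis_of fullv w ->
  exists (u : 'I_n -> 'I_r) (X : 'M[K]_n), defines_action rho w theta u X.
Proof.
move=> theta_all rho_act W_red wB.
have [u [e [eE e_free]]] := eigenbasis theta_all rho_act W_red.
pose X : 'M[K]_n := \matrix_(i, j) coord w i (e j).
have X_unit : X \in unitmx.
  (* A row vector killing the transpose of [X] is a linear relation among the [e j], read in the
     coordinates of [w]. *)
  rewrite -unitmx_tr -row_free_unit; apply: inj_row_free => v vX0.
  apply/rowP=> j; rewrite mxE; move: j; apply: e_free.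
  rewrite (coord_basis wB (memvf (\sum_i _))) big1 // => i _.
  have /rowP/(_ i) := vX0; rewrite !mxE => vX0i.
  rewrite [X in X *: _](_ : _ = 0) ?scale0r // -[RHS]vX0i linear_sum /=.
  by apply: eq_bigr => j _; rewrite linearZ !mxE.
exists u, X; split=> // a.
suff <- : action_matrix rho w a *m X = X *m diag_mx (\row_j theta (u j) a).
  by rewrite mulmxK.
rewrite mul_mx_diag; apply/matrixP=> i j; rewrite !mxE.
transitivity (coord w i (rho a (e j))); last by rewrite eE linearZ mulrC.
rewrite [in RHS](coord_basis wB (memvf (e j))) !linear_sum /=.
by apply: eq_bigr => k _; rewrite !linearZ /= !mxE mulrC.
Qed.

(** The rows of the inverse of [X] selected by [g] form a left inverse of these columns. *)
Lemma colsub_row_full (K : fieldType) (m n : nat) (g : 'I_m -> 'I_n)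
    (X : 'M[K]_n) : injective g -> X \in unitmx -> row_full (colsub g X).
Proof.
move=> g_inj X_unit; apply/row_fullP; exists (rowsub g (invmx X)).
apply/matrixP=> i j; have /matrixP/(_ (g i) (g j)) := mulVmx X_unit.
rewrite !mxE (inj_eq g_inj) => <-.
by apply: eq_bigr => k _; rewrite !mxE.
Qed.

(** The matrix [Q] of the overview, without reordering indices by fiber: the Boolean factor erases
    the entries outside the blocks. *)
Definition pivot_mx (K : fieldType) (n r : nat) (u : 'I_n -> 'I_r)
    (X : 'M[K]_n) (f : 'I_n -> 'I_n) : 'M[K]_n :=
  \matrix_(i, j) (X (f i) j *+ (u i == u j)).

Lemma pivot_mx_unit (K : fieldType) (n r : nat) (u : 'I_n -> 'I_r)
    (X : 'M[K]_n) : X \in unitmx -> exists f, pivot_mx u X f \in unitmx.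
Proof.
move=> X_unit; pose g k := @enum_val _ (mem (fiber u k)).
have g_inj k : injective (g k) by exact: enum_val_inj.
have /fin_all_exists[F F_unit] : forall k, exists f : 'I_n -> 'I_n,
    mxsub (f \o g k) (g k) X \in unitmx.
  move=> k; have full := colsub_row_full (g_inj k) X_unit.
  (* [fullrankfun full] picks rows forming an invertible block, but is indexed by positions in the
     fiber; it is transported along [g k], with an arbitrary value off the fiber. *)
  exists (fun j => if [pick q | g k q == j] is Some q then fullrankfun full q
                   else j).
  rewrite -[X in X \in _](_ : rowsub (fullrankfun full) (colsub (g k) X) = _).
    exact: fullrowsub_unit.
  apply/matrixP=> p q; rewrite !mxE /=.
  by case: pickP => [p' /eqP/g_inj-> | /(_ p)] //; rewrite eqxx.
pose f j := F (u j) j; exists f.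
rewrite -unitmx_tr -row_free_unit; apply: inj_row_free => v vQ0.
apply/rowP=> j; rewrite mxE; pose k := u j.
have j_in : j \in fiber u k by rewrite inE.
(* The rows of [Q] in the fiber of [k] vanish outside it, so the part of [v] on this fiber is killed
   by an invertible block. *)
suff /colP/(_ (enum_rank_in j_in j)) : rowsub (g k) v^T = 0.
  by rewrite !mxE /g enum_rankK_in.
apply: (can_inj (mulKmx (F_unit k))); rewrite mulmx0; apply/colP=> p.
have /rowP/(_ (g k p)) := vQ0; rewrite !mxE => vQ0p; rewrite -[RHS]vQ0p.
have ugp : u (g k p) = k.
  by have := enum_valP p; rewrite inE => /eqP.
rewrite [RHS](bigID (mem (fiber u k))) /= [X in _ + X]big1 ?addr0; last first.
  by move=> i; rewrite !mxE inE ugp eq_sym => /negPf->; rewrite mulr0.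
rewrite [RHS]big_enum_val; apply: eq_bigr => q _.
have := enum_valP q; rewrite inE !mxE /f ugp => /eqP->.
by rewrite eqxx mulrC.
Qed.

(** The diagonal matrix is scalar on each block. *)
Lemma pivot_mx_comm_diag (K : fieldType) (n r : nat) (u : 'I_n -> 'I_r)
    (X : 'M[K]_n) (f : 'I_n -> 'I_n) (d : 'I_r -> K) :
  comm_mx (pivot_mx u X f) (diag_mx (\row_j d (u j))).
Proof.
rewrite /comm_mx mul_mx_diag mul_diag_mx; apply/matrixP=> i j; rewrite !mxE.
by case: (u i =P u j) => [-> | _]; rewrite ?mulr0 ?mul0r // mulrC.
Qed.

Lemma comm_mx_invmx (K : fieldType) (n : nat) (Q D : 'M[K]_n) :
  Q \in unitmx -> comm_mx Q D -> comm_mx (invmx Q) D.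
Proof.
move=> Q_unit QD; apply: (can_inj (mulKmx Q_unit)).
by rewrite mulmxA mulmxV // mul1mx mulmxA QD mulmxK.
Qed.

Lemma pivot_rows (K : fieldType) (n r : nat) (u : 'I_n -> 'I_r)
    (X : 'M[K]_n) (f : 'I_n -> 'I_n) (i j : 'I_n) :
  pivot_mx u X f \in unitmx -> u i = u j ->
  (X *m invmx (pivot_mx u X f)) (f i) j = (i == j)%:R.
Proof.
set Q := pivot_mx u X f => Q_unit uij.
(* [D] projects onto the fiber containing [i] and [j]. Row [i] of [Q] is row [f i] of [X *m D], and
   [D] commutes with the inverse of [Q], so the entry sought is one of [Q *m invmx Q]. *)
pose d k : K := (k == u i)%:R; pose D := diag_mx (\row_l d (u l)).
have rowQ : row i Q = row (f i) (X *m D).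
  by apply/rowP=> l; rewrite mul_mx_diag !mxE eq_sym mulr_natr.
have <- : (X *m invmx Q *m D) (f i) j = (X *m invmx Q) (f i) j.
  by rewrite mul_mx_diag mxE [X in _ * X]mxE /d uij eqxx mulr1.
rewrite -mulmxA (comm_mx_invmx Q_unit (pivot_mx_comm_diag _ _ _ _)) mulmxA.
transitivity ((row (f i) (X *m D) *m invmx Q) 0 j).
  by rewrite -row_mul [RHS]mxE.
by rewrite -rowQ -row_mul mulmxV // !mxE.
Qed.

Lemma normalized_of_pivots (K : fieldType) (n r : nat) (u : 'I_n -> 'I_r)
    (X : 'M[K]_n) (f : 'I_n -> 'I_n) :
  X \in unitmx -> (forall i j, u i = u j -> X (f i) j = (i == j)%:R) ->
  normalized_invertible u X.
Proof.
move=> X_unit fX; split=> // k _.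
pose g := @enum_val _ (mem (fiber u k)); pose le := card_fiber_le u k.
have ug p : u (g p) = k by have := enum_valP p; rewrite inE => /eqP.
have fg_inj : injective (f \o g).
  move=> p q /= fpq; apply: (@enum_val_inj _ (mem (fiber u k))).
  (* The entry in row [f (g q)] and column [g q] is 1; seen in the equal row [f (g p)], it is 1 only
     if [g p] equals [g q]. *)
  have := fX (g p) (g q); rewrite fpq fX ?ug // eqxx => /(_ erefl)/eqP.
  by case: (g p =P g q) => // _; rewrite oner_eq0.
have [s sE] := perm_extends_inj le fg_inj.
(* Permuting by the inverse of [s] moves the pivot row [f (g p)] to position [p], so the top block
   is the identity and the rest serves as [Z]. *)
pose Y := castmx (esym (subnKC le), erefl)
            (row_perm s^-1 (fiber_columns u X k)).
exists (dsubmx Y), s.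
have <- : usubmx Y = 1%:M.
  apply/matrixP=> p q; rewrite /Y !mxE castmxE !mxE /=.
  have -> : cast_ord (esym (esym (subnKC le))) (lshift _ p) = s (f (g p)).
    by rewrite sE; apply/val_inj.
  by rewrite permK cast_ord_id fX ?ug // (inj_eq enum_val_inj).
rewrite vsubmxK (castmxKV (subnKC le) erefl).
by apply/matrixP=> i j; rewrite !mxE permK.
Qed.

Unset Implicit Arguments.
Set Strict Implicit.

Theorem corollary3p13 (K : fieldType) (A : falgType K)
    (r : nat) (theta : 'I_r -> {lrmorphism A -> K | *%R})
    (htheta : enumerates_characters theta)
    (W : vectType K) (rho : {linear A -> 'End(W)})
    (hrho : module_action rho)
    (n : nat) (hW : absolutely_reducible rho n)
    (w : n.-tuple W) (hw : basis_of fullv w) :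
  exists (u : 'I_n -> 'I_r) (X : 'M[K]_n),
    normalized_invertible u X /\ defines_action rho w theta u X.
Proof.
have [u [X0 [X0_unit X0E]]] := diagonalizing_matrix htheta hrho hW hw.
have [f Q_unit] := pivot_mx_unit u X0_unit.
set Q := pivot_mx u X0 f in Q_unit; pose X := X0 *m invmx Q.
have X_unit : X \in unitmx by rewrite unitmx_mul X0_unit unitmx_inv.
exists u, X; split.
  by apply: normalized_of_pivots X_unit _ => i j; apply: pivot_rows.
split=> // a; rewrite X0E; set D := diag_mx _.
have QD : comm_mx (invmx Q) D.
  exact/comm_mx_invmx/(pivot_mx_comm_diag _ _ _ (fun k => theta k a)).
(* With the inverse of [X] moved to the other side, both members reduce to [X0 *m D *m invmx Q]. *)
apply: (canRL (mulmxK X_unit)); rewrite /X -[X in _ = X]mulmxA QD !mulmxA.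
by rewrite mulmxKV.
Qed.
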